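(* Consider $\dot x=f(x,u)$ with $f(0,0)=0$, and let $K=YP^{-1}$ where $Y\in\mathbb R^{m\times n}$, $P=P^\top\in\mathbb R^{n\times n}$ and the constant $w>0$ satisfy the data-based matrix inequalities given in the context. Suppose that the controller $u=Kx$ renders the origin a locally asymptotically stable equilibrium of $\dot x=f(x,u)$ with the Lyapunov function $V(x)=x^\top P^{-1}x$. Let $\mathbb D\subseteq\mathbb R^{n+m}$ be a star-convex neighborhood of the origin such that for all $z\in\mathbb D$ and each $i=1,\dots,n$, $f_i$ is continuously differentiable (as a function of $z=(x,u)$) and $$\left|\frac{\partial f_i}{\partial z_j}(z)-\frac{\partial f_i}{\partial z_j}(0)\right|\le L_i\|z\|,\qquad j=1,\dots,m+n,$$ with known $L_i>0$. Let $c>0$ be such that $\Omega_c=\{x\in\mathbb R^n:V(x)\le c\}$ satisfies $(x,Kx)\in\mathbb D$ for all $x\in\Omega_c$. Define $$\kappa(x)=\begin{bmatrix}x^\top Q_1\|(x,Kx)\|^2&\cdots&x^\top Q_n\|(x,Kx)\|^2\end{bmatrix},$$ where $Q_i$ is the $i$th column of $P^{-1}$, and let $h_1,\dots,h_\nu$ be the distinct vertices of the polytope $\mathcal H=\{\varrho\in\mathbb R^n:-\bar h\preceq\varrho\preceq\bar h\}$ (componentwise inequalities), where $\bar h=\begin{bmatrix}\frac{\sqrt{m+n}\,L_1}{2}&\cdots&\frac{\sqrt{m+n}\,L_n}{2}\end{bmatrix}^\top$. If there exist SOS polynomials $s_{1k},s_{2k}$ in $x$, $k=1,\dots,\nu$,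 such that for every $k$ $$-\left[s_{1k}\,(c-V(x))+s_{2k}\left(-w\,x^\top P^{-1}x+2\kappa(x)h_k\right)+x^\top x\right]$$ is SOS, then $\Omega_c$ is an invariant subset of the region of attraction of the system $\dot x=f(x,Kx)$ relative to the equilibrium $x=0$.
   Context: **System.** $\dot x=f(x,u)$, $x\in\mathbb R^n$, $u\in\mathbb R^m$, $f$ unknown with components $f_i\in C^1(\mathbb R^n\times\mathbb R^m)$, $f(0,0)=0$. Let $A=\frac{\partial f}{\partial x}(0,0)$, $B=\frac{\partial f}{\partial u}(0,0)$ and $R(x,u)=f(x,u)-Ax-Bu$. **Data and over-approximation.** Noiseless samples $\dot x(t_k),x(t_k),u(t_k)$, $k=0,\dots,T-1$, with $\dot x(t_k)=f(x(t_k),u(t_k))$, are collected, and $R(x(t_k),u(t_k))^\top R(x(t_k),u(t_k))\le\gamma^2$ for $k=0,\dots,T-1$ with known $\gamma$. Put $$l(t_k)=\begin{bmatrix}u(t_k)\\ x(t_k)\end{bmatrix},\quad\mathbf A_k=l(t_k)l(t_k)^\top,\quad\mathbf B_k=-l(t_k)\dot x(t_k)^\top,\quad\mathbf C_k=\dot x(t_k)\dot x(t_k)^\top-\gamma^2I.$$ For an arbitrarily fixed constant $\delta>0$, $\overline{\mathbf A}\in\mathbb R^{(m+n)\times(m+n)}$, $\overline{\mathbf B}\in\mathbb R^{(m+n)\times n}$ (with scalars $\tau_k$) solve: minimize $-\log\det(\overline{\mathbf A})$ subject to $\overline{\mathbf A}=\overline{\mathbf A}^\top\succ0$, $\tau_k\ge0$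 for $k=0,\dots,T-1$, and $$\begin{bmatrix}-\delta I-\sum_k\tau_k\mathbf C_k & \overline{\mathbf B}^\top-\sum_k\tau_k\mathbf B_k^\top & \overline{\mathbf B}^\top\\ \overline{\mathbf B}-\sum_k\tau_k\mathbf B_k & \overline{\mathbf A}-\sum_k\tau_k\mathbf A_k & 0\\ \overline{\mathbf B}&0&-\overline{\mathbf A}\end{bmatrix}\preceq0,$$ and $\overline{\mathbf C}=\overline{\mathbf B}^\top\overline{\mathbf A}^{-1}\overline{\mathbf B}-\delta I$. **Matrix inequalities on $Y,P,w$.** $$\begin{bmatrix}wP-\overline{\mathbf C}&\overline{\mathbf B}^\top-\begin{bmatrix}Y\\ P\end{bmatrix}^\top\\ \overline{\mathbf B}-\begin{bmatrix}Y\\ P\end{bmatrix}&-\overline{\mathbf A}\end{bmatrix}\preceq0,\qquad P\succ0 .$$ **SOS polynomial:** a polynomial that is a finite sum of squares of polynomials. **Region of attraction.** For $\dot x=F(x)$, a set $\mathcal R$ is a region of attraction (RoA) with respect to the origin if $\lim_{t\to\infty}x(t)=0$ for every initial condition $x(t_0)\in\mathcal R$. If $V:\mathbb R^n\to\mathbb R$ is $C^1$, $c>0$, $\Omega_c=\{x:V(x)\le c\}$ is bounded, $V(0)=0$, $V(x)>0$ for $x\ne0$, and $\{x:V(x)\le c,\ x\neq0\}\subseteq\{x:\dot V(x)<0\}$ (with $\dot V$ the derivative along solutions of $\dot x=F(x)$), then $\Omega_c$ is called an invariant subset (or an estimation) of the RoA. *)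

(* Defs.v *)
(* The notations of mpoly clash with those of all_analysis, so it is imported
   without them:
   [mpoly n R] is the ring of polynomials in n variables over R, [mpolyC n a] a
   constant, [mpolyX R (mnm1 i)] the i-th variable. *)
From HB Require Import structures.
From mathcomp Require Import all_boot all_order all_algebra.
From mathcomp Require Import all_classical all_reals all_analysis.
From mathcomp Require mpoly.
Export -(notations) mpoly.

Set Implicit Arguments.
Unset Strict Implicit.
Unset Printing Implicit Defensive.

Import Order.TTheory GRing.Theory Num.Theory numFieldNormedType.Exports.

Local Open Scope classical_set_scope.
Local Open Scope ring_scope.

(* The next two are stated over an arbitrary commutative ring because they are
   used both for real vectors and for the vector of polynomial indeterminates. *)
Definition qform (S : comNzRingType) (n : nat) (M : 'M[S]_n) (x : 'cV[S]_n) : S :=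
  (x^T *m M *m x) 0 0.

Definition sqnorm (S : comNzRingType) (n : nat) (x : 'cV[S]_n) : S :=
  (x^T *m x) 0 0.

(* Euclidean norm; the library's [`|x|] on matrices is the maximum norm. *)
Definition enorm (R : realType) (n : nat) (x : 'cV[R]_n) : R :=
  Num.sqrt (sqnorm x).

Definition posdef (R : realType) (n : nat) (M : 'M[R]_n) : Prop :=
  M^T = M /\ forall x : 'cV[R]_n, x != 0 -> 0 < qform M x.

Definition negsemidef (R : realType) (n : nat) (M : 'M[R]_n) : Prop :=
  M^T = M /\ forall x : 'cV[R]_n, qform M x <= 0.

Definition partial (R : realType) (n : nat) (g : 'cV[R]_n -> R) (j : 'I_n)
  (z : 'cV[R]_n) : R := 'D_(delta_mx j 0) g z.

Definition C1_at (R : realType) (n : nat) (g : 'cV[R]_n -> R) (z : 'cV[R]_n) : Prop :=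
  differentiable g z /\ forall j : 'I_n, {for z, continuous (partial g j)}.

Definition C1 (R : realType) (n : nat) (g : 'cV[R]_n -> R) : Prop :=
  forall z : 'cV[R]_n, C1_at g z.

(* f_i as a function of z = (x, u) *)
Definition component (R : realType) (n m : nat)
  (f : 'cV[R]_n -> 'cV[R]_m -> 'cV[R]_n) (i : 'I_n) (z : 'cV[R]_(n + m)) : R :=
  f (usubmx z) (dsubmx z) i 0.

Definition dfdx0 (R : realType) (n m : nat)
  (f : 'cV[R]_n -> 'cV[R]_m -> 'cV[R]_n) : 'M[R]_(n, n) :=
  \matrix_(i, j) partial (component f i) (lshift m j) 0.

Definition dfdu0 (R : realType) (n m : nat)
  (f : 'cV[R]_n -> 'cV[R]_m -> 'cV[R]_n) : 'M[R]_(n, m) :=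
  \matrix_(i, j) partial (component f i) (rshift n j) 0.

Definition remainder (R : realType) (n m : nat)
  (f : 'cV[R]_n -> 'cV[R]_m -> 'cV[R]_n) (x : 'cV[R]_n) (u : 'cV[R]_m) : 'cV[R]_n :=
  f x u - dfdx0 f *m x - dfdu0 f *m u.

Section Data.
Variables (R : realType) (n m T : nat).
Variables (xdot x : 'I_T -> 'cV[R]_n) (u : 'I_T -> 'cV[R]_m) (gamma : R).

Definition dataA (k : 'I_T) : 'M[R]_(m + n) :=
  col_mx (u k) (x k) *m (col_mx (u k) (x k))^T.

Definition dataB (k : 'I_T) : 'M[R]_(m + n, n) :=
  - (col_mx (u k) (x k) *m (xdot k)^T).

Definition dataC (k : 'I_T) : 'M[R]_n :=
  xdot k *m (xdot k)^T - (gamma ^+ 2)%:M.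

Definition overapprox_lmi (delta : R) (Ab : 'M[R]_(m + n)) (Bb : 'M[R]_(m + n, n))
  (tau : 'I_T -> R) : 'M[R]_((n + (m + n)) + (m + n)) :=
  block_mx
    (block_mx (- delta%:M - \sum_k tau k *: dataC k)
              (Bb^T - \sum_k tau k *: (dataB k)^T)
              (Bb - \sum_k tau k *: dataB k)
              (Ab - \sum_k tau k *: dataA k))
    (col_mx Bb^T 0)
    (row_mx Bb 0)
    (- Ab).

Definition overapprox_feasible (delta : R) (Ab : 'M[R]_(m + n))
  (Bb : 'M[R]_(m + n, n)) (tau : 'I_T -> R) : Prop :=
  [/\ posdef Ab, forall k, 0 <= tau k & negsemidef (overapprox_lmi delta Ab Bb tau)].

Definition overapprox_optimal (delta : R) (Ab : 'M[R]_(m + n))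
  (Bb : 'M[R]_(m + n, n)) (tau : 'I_T -> R) : Prop :=
  overapprox_feasible delta Ab Bb tau /\
  forall (Ab' : 'M[R]_(m + n)) (Bb' : 'M[R]_(m + n, n)) (tau' : 'I_T -> R),
    overapprox_feasible delta Ab' Bb' tau' ->
    - ln (\det Ab) <= - ln (\det Ab').

End Data.

Definition Cbar (R : realType) (n m : nat) (delta : R) (Ab : 'M[R]_(m + n))
  (Bb : 'M[R]_(m + n, n)) : 'M[R]_n :=
  Bb^T *m invmx Ab *m Bb - delta%:M.

Definition design_lmi (R : realType) (n m : nat) (delta : R) (Ab : 'M[R]_(m + n))
  (Bb : 'M[R]_(m + n, n)) (Y : 'M[R]_(m, n)) (P : 'M[R]_n) (w : R) :
  'M[R]_(n + (m + n)) :=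
  block_mx (w *: P - Cbar delta Ab Bb) (Bb^T - (col_mx Y P)^T)
           (Bb - col_mx Y P)           (- Ab).

Section Dynamics.
Variables (R : realType) (n : nat) (F : 'cV[R]_n -> 'cV[R]_n).

(* x is a solution on [t0, +oo[ of x' = F x, x t0 = x0; the values of x before t0
   are irrelevant. *)
Definition solution_from (t0 : R) (x0 : 'cV[R]_n) (x : R -> 'cV[R]_n) : Prop :=
  [/\ x t0 = x0,
      x t @[t --> t0^'+] --> x0 &
      forall t : R, t0 < t -> is_derive t (1 : R) x (F (x t))].

Definition region_of_attraction (S : set 'cV[R]_n) : Prop :=
  forall (t0 : R) (x0 : 'cV[R]_n), S x0 ->
    (exists x, solution_from t0 x0 x) /\
    forall x, solution_from t0 x0 x -> x t @[t --> +oo] --> (0 : 'cV[R]_n).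

Definition lyapunov_stable : Prop :=
  forall eps : R, 0 < eps -> exists2 d : R, 0 < d &
    forall (t0 : R) (x0 : 'cV[R]_n), enorm x0 < d ->
      (exists x, solution_from t0 x0 x) /\
      forall x, solution_from t0 x0 x -> forall t, t0 <= t -> enorm (x t) < eps.

Definition locally_asymptotically_stable : Prop :=
  [/\ F 0 = 0, lyapunov_stable &
      exists2 r : R, 0 < r & region_of_attraction [set x | enorm x < r]].

(* The derivative of V along solutions of x' = F x. *)
Definition orbital_derivative (V : 'cV[R]_n -> R) (x : 'cV[R]_n) : R :=
  'D_(F x) V x.

Definition local_lyapunov_function (V : 'cV[R]_n -> R) : Prop :=
  [/\ C1 V, V 0 = 0 &
      \forall x \near nbhs (0 : 'cV[R]_n),
        x != 0 -> 0 < V x /\ orbital_derivative V x < 0].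

Definition sublevel (V : 'cV[R]_n -> R) (c : R) : set 'cV[R]_n :=
  [set x | V x <= c].

(* [sublevel V c] is an invariant subset (estimation) of the region of
   attraction of x' = F x with respect to the origin. *)
Definition roa_invariant_subset (V : 'cV[R]_n -> R) (c : R) : Prop :=
  C1 V /\ 0 < c /\ bounded_set (sublevel V c) /\
  V 0 = 0 /\ (forall x, x != 0 -> 0 < V x) /\
  sublevel V c `&` [set x | x != 0] `<=` [set x | orbital_derivative V x < 0].

End Dynamics.

Definition closed_loop (R : realType) (n m : nat)
  (f : 'cV[R]_n -> 'cV[R]_m -> 'cV[R]_n) (K : 'M[R]_(m, n)) (x : 'cV[R]_n) :
  'cV[R]_n := f x (K *m x).

Definition star_convex (R : realType) (n : nat) (D : set 'cV[R]_n) : Prop :=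
  forall (z : 'cV[R]_n) (t : R), D z -> 0 <= t <= 1 -> D (t *: z).

Definition box (R : realType) (n : nat) (hbar : 'cV[R]_n) : set 'cV[R]_n :=
  [set r | forall i, - hbar i 0 <= r i 0 <= hbar i 0].

(* vertex of a polytope = extreme point *)
Definition vertex (R : realType) (n : nat) (S : set 'cV[R]_n) (v : 'cV[R]_n) : Prop :=
  S v /\ forall (a b : 'cV[R]_n) (t : R), S a -> S b -> 0 < t < 1 ->
    v = t *: a + (1 - t) *: b -> a = b.

Definition sos (R : realType) (n : nat) (p : mpoly n R) : Prop :=
  exists s : seq (mpoly n R), p = \sum_(q <- s) q ^+ 2.

Definition xvar (R : realType) (n : nat) : 'cV[mpoly n R]_n :=
  \col_i mpolyX R (mnm1 i).

Definition polymx (R : realType) (n p q : nat) (M : 'M[R]_(p, q)) :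
  'M[mpoly n R]_(p, q) := map_mx (mpolyC n (R := R)) M.

Definition Vpoly (R : realType) (n : nat) (P : 'M[R]_n) : mpoly n R :=
  qform (polymx n (invmx P)) (xvar R n).

Definition kappa (R : realType) (n m : nat) (P : 'M[R]_n) (K : 'M[R]_(m, n)) :
  'rV[mpoly n R]_n :=
  \row_i (((xvar R n)^T *m polymx n (col i (invmx P))) 0 0 *
          sqnorm (col_mx (xvar R n) (polymx n K *m xvar R n))).

(* Main.v *)
Require Import Defs.
From HB Require Import structures.
From mathcomp Require Import all_boot all_order all_algebra.
From mathcomp Require Import all_classical all_reals all_analysis.
From mathcomp Require Import ring lra.

Set Implicit Arguments.
Unset Strict Implicit.
Unset Printing Implicit Defensive.

Import Order.TTheory GRing.Theory Num.Theory numFieldNormedType.Exports.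

Local Open Scope classical_set_scope.
Local Open Scope ring_scope.

(** With [p := P^-1 x] and [z := (x, K x)], the derivative of
    [V x = x^T P^-1 x] along the closed loop is
    [2 p^T f(x, K x) = 2 p^T (A + B K) x + 2 p^T rem], where [rem] is the
    remainder of [f] at [z] after its linearisation.

    The linear part is handled by the data.  Each sample says that the true
    [(B, A)] satisfies a quadratic matrix inequality; the over-approximation
    inequality combines these, with multipliers [tau k], into a single one
    satisfied by [(B, A)] ([overapprox_le0]), and adding it to the design
    inequality gives [2 p^T (A + B K) x <= - w V x] ([design_decrease]).

    The remainder is handled by the Lipschitz bound on the partial derivatives:
    the mean value theorem on the segment from [0] to [z], which stays in the
    star-convex domain, gives [rem = |z|^2 r] for some [r] in the box [H]
    ([lipschitz_gradient_remainder]).  Therefore the derivative of [V] is at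
    most [- w V x + 2 |z|^2 p^T r].  This is affine in [r], so that it is at
    most its value at some vertex of the box ([box_max_vertex]), and there the
    sum-of-squares certificate, evaluated at [x], says that it is negative
    ([certificate_neg]).

    The sublevel set is bounded because each coordinate satisfies
    [x_i^2 <= P_ii V x] ([bounded_sublevel_qform]). *)

(** * Scalar products and positive definite matrices *)

Section EuclideanProduct.
Variable R : comNzRingType.

Definition dot (n : nat) (x y : 'cV[R]_n) : R := (x^T *m y) 0 0.

Lemma dotE n (x y : 'cV[R]_n) : dot x y = \sum_i x i 0 * y i 0.
Proof. by rewrite /dot mxE; apply: eq_bigr => i _; rewrite mxE. Qed.

Lemma dotC n (x y : 'cV[R]_n) : dot x y = dot y x.
Proof. by rewrite !dotE; apply: eq_bigr => i _; rewrite mulrC. Qed.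

Lemma dotDr n (x y z : 'cV[R]_n) : dot x (y + z) = dot x y + dot x z.
Proof. by rewrite /dot mulmxDr mxE. Qed.

Lemma dotDl n (x y z : 'cV[R]_n) : dot (x + y) z = dot x z + dot y z.
Proof. by rewrite ![dot _ z]dotC dotDr. Qed.

Lemma dotZr n a (x y : 'cV[R]_n) : dot x (a *: y) = a * dot x y.
Proof. by rewrite /dot -scalemxAr mxE. Qed.

Lemma dotZl n a (x y : 'cV[R]_n) : dot (a *: x) y = a * dot x y.
Proof. by rewrite ![dot _ y]dotC dotZr. Qed.

Lemma dotNr n (x y : 'cV[R]_n) : dot x (- y) = - dot x y.
Proof. by rewrite -scaleN1r dotZr mulN1r. Qed.

Lemma dotNl n (x y : 'cV[R]_n) : dot (- x) y = - dot x y.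
Proof. by rewrite ![dot _ y]dotC dotNr. Qed.

Lemma dot0r n (x : 'cV[R]_n) : dot x 0 = 0.
Proof. by rewrite /dot mulmx0 mxE. Qed.

Lemma dot_sumr (I : finType) n (x : 'cV[R]_n) (F : I -> 'cV[R]_n) :
  dot x (\sum_i F i) = \sum_i dot x (F i).
Proof. by rewrite /dot mulmx_sumr summxE. Qed.

Lemma dot_mulmxr n p (M : 'M[R]_(p, n)) (x : 'cV[R]_p) (y : 'cV[R]_n) :
  dot x (M *m y) = dot (M^T *m x) y.
Proof. by rewrite /dot trmx_mul trmxK mulmxA. Qed.

Lemma dot_col_mx p n (a c : 'cV[R]_p) (b d : 'cV[R]_n) :
  dot (col_mx a b) (col_mx c d) = dot a c + dot b d.
Proof. by rewrite /dot tr_col_mx mul_row_col mxE. Qed.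

Lemma dot_delta_mx n (x : 'cV[R]_n) (i : 'I_n) : dot x (delta_mx i 0) = x i 0.
Proof.
rewrite dotE (bigD1 i) //= big1 ?addr0; first by rewrite mxE !eqxx mulr1.
by move=> j ji; rewrite mxE (negPf ji) mulr0.
Qed.

Lemma qform_dot n (M : 'M[R]_n) (x : 'cV[R]_n) : qform M x = dot x (M *m x).
Proof. by rewrite /qform /dot mulmxA. Qed.

Lemma sqnorm_dot n (x : 'cV[R]_n) : sqnorm x = dot x x.
Proof. by []. Qed.

Lemma mulmx_outer_dot p n (a : 'cV[R]_p) (b x : 'cV[R]_n) :
  a *m b^T *m x = dot b x *: a.
Proof.
by rewrite -mulmxA [b^T *m x]mx11_scalar mul_mx_scalar.
Qed.

End EuclideanProduct.

Section RealEuclidean.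
Variable R : realType.

Lemma sqnorm_ge0 n (x : 'cV[R]_n) : 0 <= sqnorm x.
Proof. by rewrite sqnorm_dot dotE sumr_ge0 // => i _; rewrite -expr2 sqr_ge0. Qed.

Lemma sqnorm_gt0 n (x : 'cV[R]_n) : x != 0 -> 0 < sqnorm x.
Proof.
apply: contraNT; rewrite -leNgt => x_le0; apply/eqP/matrixP => i j.
have /eqP : \sum_i x i 0 * x i 0 = 0.
  by rewrite -dotE; apply/le_anti; rewrite x_le0 sqnorm_ge0.
rewrite psumr_eq0 => [|k _]; last by rewrite -expr2 sqr_ge0.
by move=> /allP/(_ i (mem_index_enum _)); rewrite ord1 mxE mulf_eq0 orbb => /eqP.
Qed.

Lemma enorm_ge0 n (x : 'cV[R]_n) : 0 <= enorm x.
Proof. exact: sqrtr_ge0. Qed.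

Lemma sqr_enorm n (x : 'cV[R]_n) : enorm x ^+ 2 = sqnorm x.
Proof. by rewrite sqr_sqrtr ?sqnorm_ge0. Qed.

Lemma enormZ n (t : R) (x : 'cV[R]_n) : 0 <= t -> enorm (t *: x) = t * enorm x.
Proof.
move=> t0; rewrite /enorm sqnorm_dot dotZl dotZr mulrA -expr2.
by rewrite sqrtrM ?sqr_ge0 // sqrtr_sqr ger0_norm.
Qed.

Lemma posdef_ge0 n (M : 'M[R]_n) (x : 'cV[R]_n) : posdef M -> 0 <= qform M x.
Proof.
move=> [_ Mpos]; have [->|/Mpos/ltW//] := eqVneq x 0.
by rewrite qform_dot mulmx0 dot0r.
Qed.

(** The form is nonnegative at [qform M y *: x - dot x (M *m y) *: y], which is
    [qform M y] times the component of [x] orthogonal to [y] in the metric of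
    [M]. *)
Lemma posdef_cauchy_schwarz n (M : 'M[R]_n) (x y : 'cV[R]_n) :
  posdef M -> dot x (M *m y) ^+ 2 <= qform M x * qform M y.
Proof.
move=> Mpd; have [Msym Mpos] := Mpd.
have [->|/Mpos y_gt0] := eqVneq y 0.
  by rewrite !(qform_dot,mulmx0,dot0r) expr2 !mulr0.
have := posdef_ge0 (qform M y *: x - dot x (M *m y) *: y) Mpd.
have yx : dot y (M *m x) = dot x (M *m y) by rewrite dot_mulmxr Msym dotC.
rewrite qform_dot mulmxBr -!scalemxAr dotDl !dotDr !dotNr !dotNl !dotZl !dotZr yx.
rewrite -!qform_dot.
set a := qform M x; set b := qform M y; set d := dot _ _.
rewrite (_ : _ + _ = b * (a * b - d ^+ 2)); last by ring.
by rewrite pmulr_rge0 // subr_ge0.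
Qed.

Lemma posdef1 n : posdef (1%:M : 'M[R]_n).
Proof.
by split=> [|x x0]; rewrite ?trmx1 // qform_dot mul1mx -sqnorm_dot sqnorm_gt0.
Qed.

Lemma cauchy_schwarz n (x y : 'cV[R]_n) : dot x y ^+ 2 <= sqnorm x * sqnorm y.
Proof.
have := posdef_cauchy_schwarz x y (posdef1 n).
by rewrite !qform_dot !mul1mx.
Qed.

Lemma posdef_unitmx n (M : 'M[R]_n) : posdef M -> M \in unitmx.
Proof.
move=> [Msym Mpos]; rewrite -row_free_unit -kermx_eq0.
apply/eqP/row_matrixP => i; rewrite row0; apply/eqP/negPn/negP => r0.
set r := row i _ in r0.
have rM : r *m M = 0 by rewrite -row_mul mulmx_ker row0.
have := Mpos r^T; rewrite trmx_eq0 => /(_ r0).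
by rewrite /qform trmxK rM mul0mx mxE ltxx.
Qed.

Lemma posdef_invmx n (M : 'M[R]_n) : posdef M -> posdef (invmx M).
Proof.
move=> Mpd; have [Msym Mpos] := Mpd; have Mu := posdef_unitmx Mpd.
have iMsym : (invmx M)^T = invmx M by rewrite trmx_inv Msym.
split=> // x x0.
have := Mpos (invmx M *m x); rewrite !qform_dot mulKVmx // dotC; apply.
by apply: contraNneq x0 => /(congr1 (mulmx M)); rewrite mulKVmx // mulmx0 => ->.
Qed.

End RealEuclidean.

(** * Data-based decrease of the linearised closed loop *)

Section Linearisation.
Variables (R : realType) (n m T : nat).
Variables (xdot x : 'I_T -> 'cV[R]_n) (u : 'I_T -> 'cV[R]_m) (gamma delta : R).
Variables (Ab : 'M[R]_(m + n)) (Bb : 'M[R]_(m + n, n)).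

(** The quadratic matrix inequality that a sample imposes on a candidate
    [Z = (B, A)^T], tested at [y]: its left-hand side is governed by the residual
    of the sample with respect to [Z]. *)
Lemma data_qform (k : 'I_T) (Z : 'M[R]_(m + n, n)) (y : 'cV[R]_n) :
  qform (dataC xdot gamma k) y + 2 * dot (Z *m y) (dataB xdot x u k *m y)
    + qform (dataA x u k) (Z *m y)
  = dot (xdot k - Z^T *m col_mx (u k) (x k)) y ^+ 2 - gamma ^+ 2 * sqnorm y.
Proof.
rewrite !qform_dot /dataA /dataB /dataC mulNmx mulmxBl !mulmx_outer_dot mul_scalar_mx.
rewrite dotDl !dotDr !(dotNr,dotNl) !dotZr -dot_mulmxr -sqnorm_dot.
rewrite [dot y (xdot k)]dotC [dot (Z *m y) _]dotC; ring.
Qed.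

(** The S-procedure: the over-approximation inequality bounds the left-hand side
    by the combination, with the weights [tau k], of the sample inequalities. *)
Lemma overapprox_le0 (tau : 'I_T -> R) (Z : 'M[R]_(m + n, n)) (y : 'cV[R]_n) :
  overapprox_feasible xdot x u gamma delta Ab Bb tau ->
  (forall k, sqnorm (xdot k - Z^T *m col_mx (u k) (x k)) <= gamma ^+ 2) ->
  qform (Cbar delta Ab Bb) y + 2 * dot (Z *m y) (Bb *m y) + qform Ab (Z *m y) <= 0.
Proof.
move=> [Apd tau0 [_ neg]] data; have Au := posdef_unitmx Apd.
have {}data : \sum_k tau k * (qform (dataC xdot gamma k) y
    + 2 * dot (Z *m y) (dataB xdot x u k *m y) + qform (dataA x u k) (Z *m y)) <= 0.
  apply: sumr_le0 => k _; rewrite data_qform mulr_ge0_le0 //= subr_le0.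
  apply: le_trans (cauchy_schwarz _ _) _.
  by rewrite ler_wpM2r ?sqnorm_ge0.
(* This choice of the last block maximises the form for the given first two
   blocks, which amounts to taking the Schur complement of [- Ab]. *)
have := neg (col_mx (col_mx y (Z *m y)) (invmx Ab *m (Bb *m y))).
rewrite qform_dot /overapprox_lmi !mul_block_col mul_col_mx mul_row_col mul0mx.
rewrite add_col_mx addr0 !dot_col_mx !mulNmx mulKVmx //.
have tauE p q (F : 'I_T -> 'M[R]_(p, q)) a b :
    dot a ((\sum_k tau k *: F k) *m b) = \sum_k tau k * dot a (F k *m b).
  by rewrite mulmx_suml dot_sumr; apply: eq_bigr => k _; rewrite -scalemxAl dotZr.
rewrite !(mulmxDl,mulNmx,dotDr,dotNr,tauE) mul_scalar_mx dotZr.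
have trE (M : 'M[R]_(m + n, n)) z : dot y (M^T *m z) = dot z (M *m y).
  by rewrite dot_mulmxr trmxK dotC.
rewrite mul0mx dot0r trE (eq_bigr _ (fun k _ => congr1 (GRing.mul _) (trE _ _))).
have CbarE : qform (Cbar delta Ab Bb) y
    = dot (invmx Ab *m (Bb *m y)) (Bb *m y) - delta * dot y y.
  rewrite qform_dot /Cbar mulmxBl mul_scalar_mx dotDr dotNr dotZr.
  by rewrite -!mulmxA trE.
have {data} : \sum_k tau k * dot y (dataC xdot gamma k *m y)
    + 2 * (\sum_k tau k * dot (Z *m y) (dataB xdot x u k *m y))
    + \sum_k tau k * dot (Z *m y) (dataA x u k *m (Z *m y)) <= 0.
  apply: le_trans data; rewrite mulr_sumr -!big_split /= le_eqVlt; apply/orP; left.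
  by apply/eqP/eq_bigr => k _; rewrite !qform_dot; ring.
rewrite CbarE qform_dot trE; lra.
Qed.

(** Testing the design inequality at [(y, - Z y)] with [Z = (B, A)^T] and adding
    [overapprox_le0] cancels every term in [Ab] and [Bb]. *)
Lemma design_decrease (tau : 'I_T -> R) (Y : 'M[R]_(m, n)) (P : 'M[R]_n) (w : R)
    (A : 'M[R]_n) (B : 'M[R]_(n, m)) (y : 'cV[R]_n) :
  overapprox_feasible xdot x u gamma delta Ab Bb tau ->
  negsemidef (design_lmi delta Ab Bb Y P w) ->
  (forall k, sqnorm (xdot k - A *m x k - B *m u k) <= gamma ^+ 2) ->
  2 * dot y (A *m (P *m y) + B *m (Y *m y)) <= - (w * qform P y).
Proof.
move=> feas [_ neg] data.
pose Z : 'M[R]_(m + n, n) := col_mx B^T A^T.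
have ZE k : sqnorm (xdot k - Z^T *m col_mx (u k) (x k)) <= gamma ^+ 2.
  by rewrite tr_col_mx !trmxK mul_row_col opprD addrA addrAC.
have le0 := overapprox_le0 y feas ZE.
have := neg (col_mx y (- (Z *m y))).
rewrite qform_dot /design_lmi mul_block_col dot_col_mx !mulmxN !mulNmx opprK.
move: (Cbar _ _ _) le0 => C le0.
have trE (M : 'M[R]_(m + n, n)) z : dot y (M^T *m z) = dot z (M *m y).
  by rewrite dot_mulmxr trmxK dotC.
rewrite -linearB /= !(dotDr,dotNr,dotNl) trE !mulmxBl !(dotDr,dotNr).
rewrite -scalemxAl dotZr -!qform_dot.
have -> : dot (Z *m y) (col_mx Y P *m y) = dot y (A *m (P *m y) + B *m (Y *m y)).
  by rewrite dotC -trE mul_col_mx tr_col_mx !trmxK mul_row_col addrC.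
rewrite dotDr; lra.
Qed.

End Linearisation.

(** * Remainder of a function with Lipschitz gradient *)

Section Remainder.
Variable R : realType.

Lemma derive_partial n (g : 'cV[R]_n -> R) (y v : 'cV[R]_n) :
  differentiable g y -> 'D_v g y = dot v (\col_j partial g j y).
Proof.
move=> dg; rewrite deriveE // {1}(matrix_sum_delta v) linear_sum dotE.
apply: eq_bigr => j _; rewrite big_ord1 linearZ /= mxE /partial deriveE //.
Qed.

Lemma is_derive_ray n (g : 'cV[R]_n -> R) (z : 'cV[R]_n) (t : R) :
  differentiable g (t *: z) ->
  is_derive t (1 : R) (fun s : R => g (s *: z)) ('D_z g (t *: z)).
Proof.
move=> dg.
have dz : differentiable (fun s : R => s *: z) t by [].
have dgz : differentiable (g \o (fun s : R => s *: z)) t by exact: differentiable_comp.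
apply: DeriveDef; first exact/derivable1_diffP.
rewrite deriveE // diff_comp //= deriveE //; congr ('d g _ _).
by rewrite diff_val scale1r.
Qed.

(** Mean value theorem applied to [phi] and [- phi], from which the parabola
    [t |-> a / 2 * t ^+ 2] is subtracted. *)
Lemma derive_linear_bound (phi dphi : R -> R) (a : R) :
  (forall t : R, 0 <= t <= 1 -> is_derive t (1 : R) phi (dphi t)) ->
  (forall t : R, 0 <= t <= 1 -> `|dphi t| <= a * t) ->
  `|phi 1 - phi 0| <= a / 2.
Proof.
move=> dphiP dphi_le.
suff side (e : R) : `|e| = 1 -> e * (phi 1 - phi 0) <= a / 2.
  rewrite ler_norml lerNl -mulN1r side ?normrN1 //=.
  by rewrite -[X in X <= _]mul1r side ?normr1.
move=> e1.
pose psi t := e * phi t - a / 2 * t ^+ 2.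
have dpsi (t : R) : 0 <= t <= 1 -> is_derive t (1 : R) psi (e * dphi t - a * t).
  move=> t01; have := dphiP t t01 => dp.
  apply: is_derive_eq.
  by rewrite /GRing.scale /=; field.
have [t] : exists2 r, r \in `]0, 1[ & psi 1 - psi 0 = (e * dphi r - a * r) * (1 - 0).
  apply: (@MVT R psi (fun r => e * dphi r - a * r)) => // [t|].
    by rewrite in_itv /= => /andP[t0 t1]; apply: dpsi; rewrite !ltW.
  apply: derivable_within_continuous => t; rewrite in_itv /= => t01.
  by have [] := dpsi t t01.
rewrite in_itv /= => /andP[/ltW t0 /ltW t1].
have : e * dphi t <= a * t.
  apply: le_trans (ler_norm _) _; rewrite normrM e1 mul1r dphi_le //.
  by rewrite t0.
rewrite /psi expr1n expr0n /=; lra.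
Qed.

(** Along the ray [t *: z], each component of the increment of the gradient is at
    most [l * t * enorm z], so the increment has Euclidean norm at most
    [Num.sqrt n * l * t * enorm z]; integrating [t] over [0, 1] gives the
    factor [1 / 2]. *)
Lemma lipschitz_gradient_remainder n (g : 'cV[R]_n -> R) (D : set 'cV[R]_n)
    (l : R) (z : 'cV[R]_n) :
  star_convex D -> D z -> 0 <= l ->
  (forall y, D y -> differentiable g y) ->
  (forall y j, D y -> `|partial g j y - partial g j 0| <= l * enorm y) ->
  `|g z - g 0 - dot z (\col_j partial g j 0)| <= Num.sqrt n%:R * l / 2 * sqnorm z.
Proof.
move=> Dstar Dz l0 dg lip.
have Dtz t : 0 <= t <= 1 -> D (t *: z) by exact: Dstar.
pose grad y : 'cV[R]_n := \col_j partial g j y.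
pose phi t := g (t *: z) - dot z (grad 0) * t.
have -> : g z - g 0 - dot z (grad 0) = phi 1 - phi 0.
  by rewrite /phi scale1r scale0r mulr1 mulr0 subr0 addrAC.
rewrite mulrAC.
apply: (@derive_linear_bound _ (fun t => dot z (grad (t *: z) - grad 0))) => t t01.
  have := is_derive_ray (dg _ (Dtz t t01)); rewrite derive_partial; last exact/dg/Dtz.
  move=> dgt; apply: is_derive_eq.
  by rewrite /GRing.scale /= dotDr dotNr mulr1.
have [t0 _] := andP t01.
have rhs0 : 0 <= Num.sqrt n%:R * l * sqnorm z * t.
  by rewrite !mulr_ge0 ?sqrtr_ge0 ?sqnorm_ge0.
rewrite -(@ler_pXn2r _ 2) ?nnegrE // -normrX ger0_norm ?sqr_ge0 //.
apply: le_trans (cauchy_schwarz _ _) _.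
rewrite !exprMn sqr_sqrtr ?ler0n //.
rewrite (_ : _ * _ * _ * _ = sqnorm z * (n%:R * (l * (t * enorm z)) ^+ 2)); last first.
  by rewrite !exprMn sqr_enorm; ring.
rewrite ler_wpM2l ?sqnorm_ge0 // sqnorm_dot dotE.
rewrite (_ : n%:R * _ = \sum_(i < n) (l * (t * enorm z)) ^+ 2); last first.
  by rewrite sumr_const card_ord mulr_natl.
apply: ler_sum => j _; rewrite -expr2 -[leLHS]ger0_norm ?sqr_ge0 // normrX.
rewrite lerXn2r ?nnegrE ?mulr_ge0 ?enorm_ge0 //.
by rewrite !mxE -enormZ // lip //; exact: Dtz.
Qed.

End Remainder.

(** * Vertices of a box *)

Section Box.
Variables (R : realType) (n : nat).

(** An endpoint of an interval is not a proper convex combination of two points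
    of the interval unless both are equal to it. *)
Lemma vertex_box_sign (b : 'cV[R]_n) (s : 'I_n -> bool) :
  (forall i, 0 <= b i 0) -> vertex (box b) (\col_i ((-1) ^+ s i * b i 0)).
Proof.
move=> b0; split=> [i|a a' t abox a'box t01 /matrixP eqv].
  by rewrite mxE; have := b0 i; case: (s i); rewrite ?expr1 ?expr0; lra.
apply/matrixP => i j; rewrite ord1 {j}; move: (eqv i 0) (abox i) (a'box i) (b0 i).
rewrite !mxE; set p := a i 0; set q := a' i 0; set e := b i 0.
move=> {eqv} E pP qP e0.
have [] : (p = e /\ q = e) \/ (p = - e /\ q = - e); last 2 first.
- by move=> [-> ->].
- by move=> [-> ->].
move: E; case: (s i); rewrite ?expr1 ?expr0 => E; [right|left]; split; nra.
Qed.

(** The vertex whose signs are those of the coefficients of [a] maximises each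
    term of [dot a r] separately. *)
Lemma box_max_vertex (b a r : 'cV[R]_n) :
  (forall i, 0 <= b i 0) -> box b r ->
  exists2 v, vertex (box b) v & dot a r <= dot a v.
Proof.
move=> b0 rbox; exists (\col_i ((-1) ^+ (a i 0 < 0)%R * b i 0)).
  exact: vertex_box_sign.
rewrite !dotE; apply: ler_sum => i _; rewrite mxE.
by have := rbox i; have := b0 i; case: ltP => ai; rewrite ?expr1 ?expr0; nra.
Qed.

End Box.

(** * Quadratic Lyapunov functions *)

Section QuadraticForm.
Variables (R : realType) (n : nat).

Lemma derive_qform (M : 'M[R]_n) (x v : 'cV[R]_n) :
  M^T = M -> 'D_v (qform M) x = 2 * dot (M *m x) v.
Proof.
move=> Msym; rewrite /derive; apply: cvg_lim => //.
have quot h : h != 0 -> 2 * dot (M *m x) v + h * qform M v =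
    h^-1 *: ((qform M \o shift x) (h *: v) - qform M x).
  move=> h0; rewrite /= !qform_dot mulmxDr -scalemxAr dotDl !dotDr !dotZl !dotZr.
  have -> : dot v (M *m x) = dot (M *m x) v by rewrite dotC.
  have -> : dot x (M *m v) = dot (M *m x) v by rewrite dot_mulmxr Msym.
  by rewrite /GRing.scale /=; field.
apply: (@cvg_trans _ ((fun h : R => 2 * dot (M *m x) v + h * qform M v) @ 0^')).
  apply: near_eq_cvg; near=> h; apply: quot; near: h; exact: nbhs_dnbhs_neq.
apply: cvg_within_filter.
have : (fun h : R => 2 * dot (M *m x) v + h * qform M v) @ (0 : R)
    --> 2 * dot (M *m x) v + 0 * qform M v.
  by apply: cvgD; [exact: cvg_cst|apply: cvgMl; exact: cvg_id].
by rewrite mul0r addr0.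
Unshelve. all: by end_near. Qed.

(** Cauchy-Schwarz in the metric of [invmx P], as
    [x i 0 = dot x (invmx P *m (P *m delta_mx i 0))], bounds each coordinate. *)
Lemma bounded_sublevel_qform (P : 'M[R]_n) (c : R) :
  posdef P -> 0 < c -> bounded_set (sublevel (qform (invmx P)) c).
Proof.
move=> Ppd c0; have Pu := posdef_unitmx Ppd; have iPpd := posdef_invmx Ppd.
have Pge0 i : 0 <= P i i.
  have := posdef_ge0 (delta_mx i 0) Ppd.
  by rewrite qform_dot dotC dot_delta_mx -colE mxE.
have coord (x : 'cV[R]_n) i : x i 0 ^+ 2 <= qform (invmx P) x * P i i.
  have := posdef_cauchy_schwarz x (P *m delta_mx i 0) iPpd.
  by rewrite [qform _ (P *m _)]qform_dot !mulKmx // !dot_delta_mx -colE mxE.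
exists (Num.sqrt (c * \tr P)); split=> [|M /ltW bM x xc]; first exact: num_real.
apply: le_trans bM; rewrite [leLHS]/Num.norm /= mx_normrE.
apply/bigmax_leP; split=> [|[i j] _]; first exact: sqrtr_ge0.
rewrite ord1 /= -sqrtr_sqr ler_sqrt; last by rewrite mulr_ge0 ?sumr_ge0 ?ltW.
apply: le_trans (coord x i) _; apply: ler_pM => //; first exact: posdef_ge0.
by rewrite /mxtrace (bigD1 i) //= lerDl sumr_ge0.
Qed.

End QuadraticForm.

(** * Evaluation of the polynomial certificate *)

(** The positive [q] and the nonnegative [s1 * (c - v)] have to be outweighed by
    [s2 * a], and the multiplier [s2] is nonnegative. *)
Lemma multiplier_neg (R : realDomainType) (s1 s2 v q a c : R) :
  0 < q -> v <= c -> 0 <= s1 -> 0 <= s2 ->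
  0 <= - (s1 * (c - v) + s2 * a + q) -> a < 0.
Proof.
move=> q_gt0 vc s1_ge0 s2_ge0 sum_ge0; rewrite ltNge; apply/negP => a_ge0.
have := mulr_ge0 s2_ge0 a_ge0.
have : 0 <= s1 * (c - v) by rewrite mulr_ge0 // subr_ge0.
lra.
Qed.

Section Certificate.
Variables (R : realType) (n : nat) (y : 'cV[R]_n).

Local Notation ev := (meval (fun i => y i 0)).

Lemma meval_sos_ge0 (p : mpoly n R) : sos p -> 0 <= ev p.
Proof.
move=> [s ->]; rewrite rmorph_sum sumr_ge0 // => q _.
by rewrite rmorphXn /= sqr_ge0.
Qed.

Lemma meval_xvar : map_mx ev (xvar R n) = y.
Proof. by apply/matrixP => i j; rewrite !mxE ord1 mevalXU. Qed.

Lemma meval_polymx p q (M : 'M[R]_(p, q)) : map_mx ev (polymx n M) = M.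
Proof. by apply/matrixP => i j; rewrite !mxE mevalC. Qed.

Lemma meval_qform (M : 'M[mpoly n R]_n) (x : 'cV[mpoly n R]_n) :
  ev (qform M x) = qform (map_mx ev M) (map_mx ev x).
Proof. by rewrite /qform map_trmx -!map_mxM [RHS]mxE. Qed.

Lemma meval_sqnorm p (x : 'cV[mpoly n R]_p) : ev (sqnorm x) = sqnorm (map_mx ev x).
Proof. by rewrite /sqnorm map_trmx -map_mxM [RHS]mxE. Qed.

Lemma meval_Vpoly (P : 'M[R]_n) : ev (Vpoly P) = qform (invmx P) y.
Proof. by rewrite meval_qform meval_polymx meval_xvar. Qed.

Lemma meval_kappa m (P : 'M[R]_n) (K : 'M[R]_(m, n)) (r : 'cV[R]_n) :
  ev ((kappa P K *m polymx n r) 0 0) =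
  sqnorm (col_mx y (K *m y)) * dot ((invmx P)^T *m y) r.
Proof.
have -> : ev ((kappa P K *m polymx n r) 0 0) = (map_mx ev (kappa P K) *m r) 0 0.
  by rewrite -[in RHS](meval_polymx r) -map_mxM [in RHS]mxE.
rewrite mxE dotE mulr_sumr; apply: eq_bigr => i _.
have -> : map_mx ev (kappa P K) 0 i =
    ((invmx P)^T *m y) i 0 * sqnorm (col_mx y (K *m y)).
  rewrite 2!mxE rmorphM /= meval_sqnorm map_col_mx map_mxM meval_polymx meval_xvar.
  congr (_ * _).
  have -> : ev (((xvar R n)^T *m polymx n (col i (invmx P))) 0 0) =
      (map_mx ev ((xvar R n)^T *m polymx n (col i (invmx P)))) 0 0 by rewrite [RHS]mxE.
  rewrite map_mxM -map_trmx meval_polymx meval_xvar !mxE.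
  by apply: eq_bigr => j _; rewrite !mxE mulrC.
by ring.
Qed.

Lemma certificate_neg m (P : 'M[R]_n) (K : 'M[R]_(m, n)) (w c : R) (r : 'cV[R]_n)
    (s1 s2 : mpoly n R) :
  y != 0 -> qform (invmx P) y <= c -> sos s1 -> sos s2 ->
  sos (- (s1 * (mpolyC n c - Vpoly P)
          + s2 * (- (mpolyC n w * Vpoly P)
                  + 2 * (kappa P K *m polymx n r) 0 0)
          + sqnorm (xvar R n))) ->
  - (w * qform (invmx P) y)
    + 2 * (sqnorm (col_mx y (K *m y)) * dot ((invmx P)^T *m y) r) < 0.
Proof.
move=> y0 yc /meval_sos_ge0 s1_ge0 /meval_sos_ge0 s2_ge0 /meval_sos_ge0.
have := sqnorm_gt0 y0; rewrite -[in sqnorm y]meval_xvar -meval_sqnorm.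
rewrite -meval_kappa -meval_Vpoly in yc *.
rewrite ![2 * _]mulr_natl rmorphN !rmorphD rmorphM rmorphB /= mevalC.
rewrite rmorphM rmorphD rmorphN rmorphMn rmorphM /= mevalC.
by move=> q0 sum_ge0; apply: (multiplier_neg q0 yc s1_ge0 s2_ge0 sum_ge0).
Qed.

End Certificate.

(** * Invariant subset of the region of attraction *)

(** The two Jacobian blocks of the linearisation are the two parts of the gradient
    of the component in [z = (x, u)]. *)
Lemma remainder_component (R : realType) (n m : nat)
    (f : 'cV[R]_n -> 'cV[R]_m -> 'cV[R]_n) (x : 'cV[R]_n) (u : 'cV[R]_m) (i : 'I_n) :
  f 0 0 = 0 ->
  remainder f x u i 0 = component f i (col_mx x u) - component f i 0
    - dot (col_mx x u) (\col_j partial (component f i) j 0).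
Proof.
move=> f0; have -> : component f i 0 = 0 by rewrite /component !linear0 f0 mxE.
rewrite /component col_mxKu col_mxKd subr0.
rewrite dotC dotE big_split_ord /= opprD addrA !mxE; congr (_ - _ - _).
  by apply: eq_bigr => j _; rewrite col_mxEu !mxE.
by apply: eq_bigr => j _; rewrite col_mxEd !mxE.
Qed.

Theorem proposition1 (R : realType) (n m T : nat)
  (f : 'cV[R]_n -> 'cV[R]_m -> 'cV[R]_n)
  (fC1 : forall i : 'I_n, C1 (component f i))
  (f0 : f 0 0 = 0)
  (xdot x : 'I_T -> 'cV[R]_n) (u : 'I_T -> 'cV[R]_m)
  (samples : forall k : 'I_T, xdot k = f (x k) (u k))
  (gamma : R)
  (remainder_bound : forall k : 'I_T, sqnorm (remainder f (x k) (u k)) <= gamma ^+ 2)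
  (delta : R) (delta_gt0 : 0 < delta)
  (Ab : 'M[R]_(m + n)) (Bb : 'M[R]_(m + n, n)) (tau : 'I_T -> R)
  (overapprox : overapprox_optimal xdot x u gamma delta Ab Bb tau)
  (Y : 'M[R]_(m, n)) (P : 'M[R]_n) (w : R) (K : 'M[R]_(m, n))
  (w_gt0 : 0 < w) (P_posdef : posdef P)
  (lmi : negsemidef (design_lmi delta Ab Bb Y P w))
  (K_def : K = Y *m invmx P)
  (V : 'cV[R]_n -> R)
  (V_def : V = fun y : 'cV[R]_n => qform (invmx P) y)
  (las : locally_asymptotically_stable (closed_loop f K))
  (V_lyapunov : local_lyapunov_function (closed_loop f K) V)
  (D : set 'cV[R]_(n + m)) (D_nbhs : nbhs (0 : 'cV[R]_(n + m)) D)
  (D_star : star_convex D)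
  (L : 'I_n -> R) (L_gt0 : forall i : 'I_n, 0 < L i)
  (f_C1_on_D : forall (z : 'cV[R]_(n + m)) (i : 'I_n), D z -> C1_at (component f i) z)
  (f_lipschitz : forall (z : 'cV[R]_(n + m)) (i : 'I_n) (j : 'I_(n + m)), D z ->
     `|partial (component f i) j z - partial (component f i) j 0| <= L i * enorm z)
  (c : R) (c_gt0 : 0 < c)
  (sublevel_D : forall y : 'cV[R]_n, sublevel V c y -> D (col_mx y (K *m y)))
  (nu : nat) (h : 'I_nu -> 'cV[R]_n) (h_distinct : injective h)
  (h_vertices : forall v : 'cV[R]_n,
     vertex (box (\col_i (Num.sqrt (m + n)%:R * L i / 2))) v <-> exists k, h k = v)
  (certificate : exists s1 s2 : 'I_nu -> mpoly n R, forall k : 'I_nu,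
     [/\ sos (s1 k), sos (s2 k) &
         sos (- (s1 k * (mpolyC n c - Vpoly P)
                 + s2 k * (- (mpolyC n w * Vpoly P)
                           + 2 * (kappa P K *m polymx n (h k)) 0 0)
                 + sqnorm (xvar R n)))]) :
  roa_invariant_subset (closed_loop f K) V c.
Proof.
have iPpd := posdef_invmx P_posdef; have [iPsym iPpos] := iPpd.
have [C1V V0 _] := V_lyapunov.
split=> //; split=> //; split; first by rewrite V_def; exact: bounded_sublevel_qform.
split=> //; split=> [y y0|y [yc y0] /=]; first by rewrite V_def iPpos.
rewrite /orbital_derivative; move: (yc); rewrite /sublevel /= V_def derive_qform //.
move=> {}yc'; set z := col_mx y (K *m y); set p := invmx P *m y.
have z_gt0 : 0 < sqnorm z.
  apply: sqnorm_gt0; apply: contraNneq y0 => /(congr1 usubmx).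
  by rewrite col_mxKu linear0 => ->.
pose b : 'cV[R]_n := \col_i (Num.sqrt (m + n)%:R * L i / 2).
have b0 i : 0 <= b i 0 by rewrite mxE divr_ge0 // mulr_ge0 ?sqrtr_ge0 // ltW.
pose rem := remainder f y (K *m y).
have remP i : `|rem i 0| <= b i 0 * sqnorm z.
  rewrite /rem remainder_component // mxE.
  rewrite (_ : (m + n)%:R = (n + m)%:R); last by rewrite addnC.
  apply: (lipschitz_gradient_remainder D_star (sublevel_D _ yc)) => // [|v Dv|v j Dv].
  - exact/ltW.
  - by have [] := f_C1_on_D v i Dv.
  - exact: f_lipschitz.
(* The point of the box that the actual remainder corresponds to. *)
pose r := (sqnorm z)^-1 *: rem.
have rbox : box b r.
  move=> i; rewrite -ler_norml [r i 0]mxE normrM gtr0_norm ?invr_gt0 //.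
  by rewrite ler_pdivrMl // mulrC.
have [v /h_vertices[k <-] rv] := box_max_vertex p b0 rbox.
have [s1 [s2 /(_ k)[s1sos s2sos cert]]] := certificate.
have := certificate_neg y0 yc' s1sos s2sos cert; rewrite iPsym -/z -/p.
have [feas _] := overapprox; have Pu := posdef_unitmx P_posdef.
have data k' : sqnorm (xdot k' - dfdx0 f *m x k' - dfdu0 f *m u k') <= gamma ^+ 2.
  by rewrite samples; exact: remainder_bound.
have := design_decrease p feas lmi data.
have Pp : P *m p = y by rewrite mulKVmx.
have -> : Y *m p = K *m y by rewrite K_def mulmxA.
have -> : qform P p = qform (invmx P) y by rewrite !qform_dot Pp dotC.
rewrite Pp => linear_part.
have -> : closed_loop f K y = dfdx0 f *m y + dfdu0 f *m (K *m y) + rem.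
  by rewrite /rem /remainder [RHS]addrC addrACA subrK addNr addr0.
have -> : rem = sqnorm z *: r by rewrite scalerA divff ?scale1r ?gt_eqF.
rewrite dotDr dotZr.
have := ler_wpM2l (ltW z_gt0) rv.
lra.
Qed.
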